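(* Suppose that the gross payoffs satisfy (P1)–(P5), the cost functional satisfies (C1)–(C3), and the following strict tie disadvantage holds: for each $x_0\in(0,1)$ there exist $\delta(x_0)\in(0,1-x_0]$ and $\Delta(x_0)>0$ such that for every $z=(x_2,\dots,x_n)\in X^{n-1}$ with $\max_{2\le j\le n}x_j=x_0$ and every $\varepsilon\in(0,\delta(x_0)]$, $\pi_1(x_0+\varepsilon,z)\ge\pi_1(x_0,z)+\Delta(x_0)$. If $F\in\mathcal F$ is a symmetric equilibrium, then $dF(\{x\})=0$ for every $x\in(0,1)$.
   Context: Let $n\ge 2$ and $X=[0,1]$. Let $\mathcal F$ be the set of cdfs on $X$: right-continuous nondecreasing $F:[0,1]\to[0,1]$ with $F(1)=1$. Each $F\in\mathcal F$ induces a unique Borel probability measure $dF$ on $X$ with $dF([0,x])=F(x)$. $\mathcal F$ carries the topology of weak convergence of the measures $dF$. Each player $i$ chooses $F_i\in\mathcal F$; performances $X_i\sim dF_i$ are drawn independently. Gross payoffs are Borel functions $\pi_i:X^n\to\mathbb R$, $i=1,\dots,n$ (expected payoffs given the realized performances, after averaging over uniform tie-breaking), satisfying: (P1) there is $\bar\pi<\infty$ with $0\le\pi_i\le\bar\pi$ for all $i$; (P2) for every permutation $\sigma$ of $\{1,\dots,n\}$, every $i$ and $x$: $\pi_i(x_{\sigma(1)},\dots,x_{\sigma(n)})=\pi_{\sigma(i)}(x_1,\dots,x_n)$; (P3) $\pi_i$ is continuous at every $x\in X^n$ with $x_i\ne x_j$ for all $j\neq i$; (P4) for each $i$, $x_{-i}$,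 and $x_i'\ge x_i$: $\pi_i(x_i',x_{-i})\ge\pi_i(x_i,x_{-i})$; (P5) there is a bounded continuous symmetric function $\Pi:X^n\to\mathbb R$ with $\sum_{i=1}^n\pi_i(x)=\Pi(x)$ for all $x\in X^n$. The cost $C:\mathcal F\to\mathbb R$ satisfies: (C1) $C$ is convex and continuous with respect to weak convergence; (C2) for each $F\in\mathcal F$ there is a continuous $c_F:X\to\mathbb R$ such that for all $G\in\mathcal F$ the limit $\delta C(F;G-F)=\lim_{\varepsilon\downarrow0}\varepsilon^{-1}\left[C((1-\varepsilon)F+\varepsilon G)-C(F)\right]$ exists and equals $\int_X c_F(x)\,d(G-F)(x)$; (C3) there is $\eta_1>0$ such that $c_F(1)\ge c_F(0)+\bar\pi+\eta_1$ for every $F\in\mathcal F$. Player $i$'s net payoff is $u_i(F_1,\dots,F_n)=\mathbb E[\pi_i(X_1,\dots,X_n)]-C(F_i)$. $F\in\mathcal F$ is a symmetric equilibrium if $u_1(F,F,\dots,F)\ge u_1(H,F,\dots,F)$ for all $H\in\mathcal F$. *)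

(* Defs.v *)
From HB Require Import structures.
From mathcomp Require Import all_boot all_order all_algebra all_fingroup.
From mathcomp Require Import all_classical all_reals all_analysis.

Set Implicit Arguments.
Unset Strict Implicit.
Unset Printing Implicit Defensive.

Import Order.TTheory GRing.Theory Num.Theory.
Import numFieldNormedType.Exports.

Local Open Scope classical_set_scope.
Local Open Scope ring_scope.

Section product_law.
Context d (T : measurableType d) (R : realType).

Definition cons_pair n (p : T * n.-tuple T) : n.+1.-tuple T :=
  [tuple of p.1 :: p.2].

Lemma measurable_cons_pair n : measurable_fun setT (@cons_pair n).
Proof. exact: (measurable_cons measurable_fst measurable_snd). Qed.

HB.instance Definition _ n :=
  isMeasurableFun.Build _ _ _ _ (@cons_pair n) (@measurable_cons_pair n).

(* The law on n.-tuple T of independent coordinates with laws P 0, ..., P n-1;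
   see product_law_box. *)
Fixpoint product_law n :
    ('I_n -> probability T R) -> probability (n.-tuple T) R :=
  match n with
  | 0 => fun _ => \d_([tuple] : 0.-tuple T)
  | m.+1 => fun P =>
      distribution (P ord0 \x product_law (fun i => P (lift ord0 i)))%E
        (@cons_pair m)
  end.

Lemma product_law_box n (P : 'I_n -> probability T R) (A : 'I_n -> set T) :
  (forall i, measurable (A i)) ->
  product_law P [set t | forall i, A i (tnth t i)] = (\prod_(i < n) P i (A i))%E.
Proof.
elim: n => [|n IH] in P A * => mA.
  by rewrite big_ord0 /= diracE mem_set//= => -[].
rewrite big_ord_recl /= -IH//.
rewrite /distribution /pushforward /= -product_measure1E//; last first.
  rewrite [X in measurable X](_ : _ = \bigcap_(i in [set: 'I_n])
      (@tnth n T ^~ i @^-1` A (lift ord0 i))).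
    apply: fin_bigcap_measurable => // i _.
    by rewrite -[X in measurable X]setTI; exact: measurable_tnth.
  by apply/seteqP; split => [t h i _|t h i]; [exact: h|exact: (h i)].
congr (_ _); apply/seteqP; split => [[x t] /= h|[x t] /= [h1 h2] i].
  by split=> [|i]; [have := h ord0|have := h (lift ord0 i); rewrite tnthS].
by case: (unliftP ord0 i) => [j ->|->//]; rewrite tnthS.
Qed.

End product_law.

Section cdf01.
Context {R : realType}.

(* A cdf F : [0, 1] -> [0, 1], identified with its extension to R by 0 on the
   left of 0 and by 1 on the right of 1; F may jump at 0. *)
Record cdf01 := Cdf01 {
  cdf_fun :> R -> R ;
  cdf_nd : nondecreasing cdf_fun ;
  cdf_rc : right_continuous cdf_fun ;
  cdf_lt0 : forall x, x < 0 -> cdf_fun x = 0 ;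
  cdf_ge1 : forall x, 1 <= x -> cdf_fun x = 1 }.

Lemma cdf01P (F G : cdf01) : (forall x, x \in `[0, 1] -> F x = G x) -> F = G.
Proof.
case: F G => [f nf rf f0 f1] [g ng rg g0 g1] /= fg.
have e : f = g.
  apply/funext => x; have [x0|x0] := ltP x 0; first by rewrite f0// g0.
  have [x1|x1] := leP 1 x; first by rewrite f1// g1.
  by apply: fg; rewrite in_itv/= x0 ltW.
move: nf rf f0 f1; rewrite e => *.
by congr Cdf01; exact: Prop_irrelevance.
Qed.

HB.instance Definition _ (F : cdf01) :=
  isCumulative.Build R _ R (cdf_fun F) (@cdf_nd F) (@cdf_rc F).

Lemma cdf_cvgNy (F : cdf01) : cdf_fun F @ -oo --> (0 : R).
Proof.
apply: cvg_near_cst; near=> x; rewrite cdf_lt0//.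
Unshelve. all: by end_near. Qed.

Lemma cdf_cvgy (F : cdf01) : cdf_fun F @ +oo --> (1 : R).
Proof.
apply: cvg_near_cst; near=> x; rewrite cdf_ge1//.
Unshelve. all: by end_near. Qed.

HB.instance Definition _ (F : cdf01) :=
  isCumulativeBounded.Build R 0 1 (cdf_fun F) (cdf_cvgNy F) (cdf_cvgy F).

Definition law (F : cdf01) : probability (measurableTypeR R) R :=
  lebesgue_stieltjes_measure (cdf_fun F).

Lemma law_itvNy (F : cdf01) (x : R) : law F `]-oo, x]%classic = (F x)%:E.
Proof. by rewrite -cdf_lebesgue_stieltjes_id /cdf /distribution. Qed.

Lemma law_itv0 (F : cdf01) (x : R) : 0 <= x -> law F `[0, x]%classic = (F x)%:E.
Proof.
move=> x0; have N0 : law F `]-oo, 0[%classic = 0%E.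
  have -> : `]-oo, 0[%classic = \bigcup_k `]-oo, (- k.+1%:R^-1 : R)]%classic.
    apply/seteqP; split => [y /=|y [k _] /=]; rewrite !in_itv/=.
      rewrite -oppr_gt0 => y0; exists (Num.truncn (- y)^-1) => //=.
      rewrite in_itv/= lerNr invf_ple ?posrE//.
      exact/ltW/truncnS_gt.
    by move=> /le_lt_trans; apply; rewrite oppr_lt0 invr_gt0.
  apply/eqP; rewrite eq_le measure_ge0 andbT.
  apply: (le_trans (@measure_sigma_subadditive _ _ _ (law F) _
    (fun k => `]-oo, (- k.+1%:R^-1 : R)]%classic) _ _ _)) => //.
    apply: bigcup_measurable => k _; exact: (@measurable_itv R).
  by rewrite eseries0// => k _ _; rewrite [LHS]law_itvNy cdf_lt0// oppr_lt0 invr_gt0.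
rewrite -law_itvNy.
have -> : `]-oo, x]%classic = `]-oo, 0[%classic `|` `[0, x]%classic.
  apply/seteqP; split => [y|y []] /=; rewrite !in_itv/=.
  - by case: ltP => y0 yx; [left|right].
  - by move=> /ltW/le_trans; exact.
  - by case/andP.
have I0 : `]-oo, 0[%classic `&` `[0, x]%classic = set0 :> set R.
  apply/seteqP; split => // y [] /=; rewrite !in_itv/= => y0 /andP[].
  by rewrite leNgt y0.
rewrite [RHS](@measureU _ _ _ (law F) _ _ _ _ I0)//.
by rewrite [X in _ = (X + _)%E](_ : _ = 0%E)// add0e.
Qed.

(* The topology of weak convergence: the coarsest one making F |-> \int phi dF
   continuous for every continuous phi : [0, 1] -> R. *)
Definition weak_ev (F : cdf01) :
    {ptws {phi : R -> R | {within `[0, 1], continuous phi}} -> R} :=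
  fun phi => \int[law F]_(x in `[0, 1]) sval phi x.

HB.instance Definition _ := gen_eqMixin cdf01.
HB.instance Definition _ := gen_choiceMixin cdf01.
HB.instance Definition _ := Topological.copy cdf01 (initial_topology weak_ev).

(* The mixture (1 - e) F + e G, see mixE; e is clamped to [0, 1] so that mix is
   total. *)
Definition clamp (e : R) : R := Num.max 0 (Num.min 1 e).

Definition mix_fun (e : R) (F G : cdf01) (x : R) : R :=
  (1 - clamp e) * F x + clamp e * G x.

Lemma clamp_itv e : 0 <= clamp e <= 1.
Proof. by rewrite /clamp le_max lexx ge_max ler01 ge_min lexx. Qed.

Lemma mix_nd e F G : nondecreasing (mix_fun e F G).
Proof.
move=> x y xy; have /andP[e0 e1] := clamp_itv e.
by rewrite lerD// ler_wpM2l ?subr_ge0// cdf_nd.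
Qed.

Lemma mix_rc e F G : right_continuous (mix_fun e F G).
Proof. by move=> x; apply: cvgD; apply: cvgMr; exact: cdf_rc. Qed.

Lemma mix_lt0 e F G x : x < 0 -> mix_fun e F G x = 0.
Proof. by move=> x0; rewrite /mix_fun !cdf_lt0// !mulr0 addr0. Qed.

Lemma mix_ge1 e F G x : 1 <= x -> mix_fun e F G x = 1.
Proof. by move=> x1; rewrite /mix_fun !cdf_ge1// !mulr1 subrK. Qed.

Definition mix (e : R) (F G : cdf01) : cdf01 :=
  Cdf01 (@mix_nd e F G) (@mix_rc e F G) (@mix_lt0 e F G) (@mix_ge1 e F G).

Lemma mixE e (F G : cdf01) x :
  0 <= e <= 1 -> mix e F G x = (1 - e) * F x + e * G x.
Proof.
by move=> /andP[e0 e1]; rewrite /= /mix_fun /clamp min_r// max_r.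
Qed.

End cdf01.
Arguments cdf01 : clear implicits.

Section costs.
Context {R : realType}.
Variables (C : cdf01 R -> R) (c : cdf01 R -> R -> R).

Definition cost_convex : Prop :=
  forall e F G, 0 <= e <= 1 -> C (mix e F G) <= (1 - e) * C F + e * C G.

Definition cost_derivative : Prop :=
  forall F, {within `[0, 1], continuous (c F)} /\
    forall G,
      (e^-1 * (C (mix e F G) - C F)) @[e --> 0^'+] -->
      (\int[law G]_(x in `[0, 1]) c F x - \int[law F]_(x in `[0, 1]) c F x : R).

Definition cost_slope (pibar : R) : Prop :=
  exists2 eta1 : R, 0 < eta1 & forall F, c F 0 + pibar + eta1 <= c F 1.

End costs.

Section payoffs.
Context {R : realType} {n : nat}.

Definition cube : set {ptws 'I_n -> R} := [set x | forall j, x j \in `[0, 1]].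

Definition upd (x : {ptws 'I_n -> R}) (i : 'I_n) (a : R) : {ptws 'I_n -> R} :=
  fun j => if j == i then a else x j.

Variable g : 'I_n -> {ptws 'I_n -> R} -> R.

(* The Borel sets of R^n are those of the product sigma-algebra, which the
   library provides on n.-tuple. *)
Definition payoffs_borel : Prop := forall i,
  measurable_fun [set t : n.-tuple (measurableTypeR R) | cube (tnth t)]
    (fun t => g i (tnth t)).

Definition payoffs_bounded (pibar : R) : Prop :=
  forall i x, cube x -> 0 <= g i x <= pibar.

Definition payoffs_symmetric : Prop :=
  forall (s : 'S_n) i x, cube x -> g i (x \o s) = g (s i) x.

Definition payoffs_continuous_off_ties : Prop :=
  forall i x, cube x -> (forall j, j != i -> x i != x j) ->
    g i y @[y --> within cube (nbhs x)] --> g i x.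

Definition payoffs_monotone : Prop :=
  forall i x a, cube x -> a \in `[0, 1] -> x i <= a -> g i x <= g i (upd x i a).

Definition payoffs_total_continuous : Prop :=
  exists Pi : {ptws 'I_n -> R} -> R,
    [/\ exists M, forall x, cube x -> `|Pi x| <= M,
        {within cube, continuous Pi},
        forall (s : 'S_n) x, cube x -> Pi (x \o s) = Pi x
      & forall x, cube x -> \sum_(i < n) g i x = Pi x].

(* The opponents' profile z is encoded by a point of the cube whose i-th
   coordinate is overwritten by upd. *)
Definition strict_tie_disadvantage (i : 'I_n) : Prop :=
  forall x0 : R, 0 < x0 < 1 ->
  exists delta Delta : R, [/\ 0 < delta <= 1 - x0, 0 < Delta &
    forall z, cube z -> \big[Num.max/0]_(j < n | j != i) z j = x0 ->
    forall e, 0 < e <= delta ->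
      g i (upd z i x0) + Delta <= g i (upd z i (x0 + e))].

Variable C : cdf01 R -> R.

Definition net_payoff (i : 'I_n) (F : 'I_n -> cdf01 R) : R :=
  \int[product_law (fun j => law (F j))]_(t in [set t | cube (tnth t)])
    g i (tnth t) - C (F i).

Definition symmetric_equilibrium (i : 'I_n) (F : cdf01 R) : Prop :=
  forall H : cdf01 R,
    net_payoff i (fun j => if j == i then H else F) <=
    net_payoff i (fun=> F).

End payoffs.

(* Main.v *)
(* Suppose F has an atom of mass mu at x in (0, 1).  Moving a fraction of this
   atom up to x + e is a deviation along a segment of cdfs, so by the first-order
   condition its marginal gain per unit of mass is at most c_F(x + e) - c_F(x),
   which vanishes as e -> 0 by continuity of c_F.  But with probability
   mu^(n-1) > 0 all opponents perform exactly x, and then the move breaks the tie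
   and gains at least Delta, while by monotonicity it never loses: the marginal
   gain is at least Delta mu^(n-1), uniformly in e, a contradiction. *)
Require Import Defs.
From mathcomp Require Import all_boot all_order all_algebra.
From mathcomp Require Import all_classical all_reals all_analysis.
From mathcomp Require Import measurable_realfun ring lra.
Import Order.TTheory GRing.Theory Num.Theory.
Import numFieldNormedType.Exports.
Local Open Scope classical_set_scope.
Local Open Scope ring_scope.

(** * Laws that differ by moving an atom *)

(** The intervals []a, b]] are stable under intersection, generate the Borel sets and exhaust the
    line; each is a difference of two rays, and finiteness on rays lets the masses be subtracted.
    Total mass is left free because [law_shift] compares measures that need not be probabilities. *)
Lemma measure_eq_rays (R : realType)
    (m1 m2 : {measure set (measurableTypeR R) -> \bar R}) :
  (forall x : R, m1 `]-oo, x]%classic < +oo)%E ->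
  (forall x : R, m1 `]-oo, x]%classic = m2 `]-oo, x]%classic) ->
  forall A, measurable A -> m1 A = m2 A.
Proof.
move=> m1fin m12 A mA.
have m2fin (x : R) : (m2 `]-oo, x]%classic < +oo)%E by rewrite -m12.
have mray (x : R) : measurable (`]-oo, x]%classic : set (measurableTypeR R)).
  exact: (@measurable_itv R).
apply: (@measure_unique _ R (measurableTypeR R) (@ocitv R)
  (fun k => `](- k%:R), k%:R]%classic) _ _ _ _ m1 m2 _ _ A mA) => //.
- exact: ocitvI.
- by move=> k; exact: is_ocitv.
- apply/seteqP; split => // x _; exists (Num.truncn `|x|).+1 => //=.
  rewrite in_itv/=.
  by have := truncnS_gt `|x|; rewrite ltr_norml => /andP[-> /ltW].
- move=> _ [[a b] _ <-] /=.
  have [ab|ba] := leP a b; last by rewrite set_itv_ge ?measure0// bnd_simp -leNgt ltW.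
  have -> : `]a, b]%classic = `]-oo, b] `\` `]-oo, a] :> set R.
    by rewrite -[RHS]setCK setCD setCitvl setUC -[LHS]setCK setCitv.
  have s : (`]-oo, a]%classic : set R) `<=` `]-oo, b] by exact: subset_itvl.
  have -> := @measureD _ _ _ m1 _ _ (mray b) (mray a) (m1fin b).
  have -> := @measureD _ _ _ m2 _ _ (mray b) (mray a) (m2fin b).
  by rewrite (setIidr s); congr (_ - _)%E; exact: m12.
- move=> k; apply: le_lt_trans (m1fin k%:R); apply: le_measure; rewrite ?inE//.
  by move=> x; rewrite /= !in_itv/= => /andP[].
Qed.

(** [H] arises from [F] by carrying mass [s] from [a] to [b]. The Dirac terms are added on opposite
    sides, so that for [s >= 0] both sides are distribution functions of positive measures. *)
Definition mass_moved {R : realType} (s a b : R) (F H : cdf01 R) : Prop :=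
  forall y, H y + s * (a <= y)%R%:R = F y + s * (b <= y)%R%:R.

Lemma law_shift {R : realType} {a b : R} {F H : cdf01 R} {s : {nonneg R}} :
  mass_moved s%:num a b F H ->
  forall A : set (measurableTypeR R), measurable A ->
    measure_add (law H) (mscale s (\d_(a : measurableTypeR R))) A =
    measure_add (law F) (mscale s (\d_(b : measurableTypeR R))) A.
Proof.
move=> HF; have E (G : cdf01 R) (z x : R) :
    measure_add (law G) (mscale s (\d_(z : measurableTypeR R))) `]-oo, x]%classic
    = (G x + s%:num * (z <= x)%R%:R)%:E.
  rewrite measure_addE EFinD EFinM; congr (_ + _)%E; first exact: law_itvNy.
  rewrite /mscale/=; congr (_ * _)%E.
  transitivity (\d_(z : measurableTypeR R) `]-oo, x]%classic : \bar R)%E => //.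
  by rewrite diracE mem_setE in_itv.
apply: measure_eq_rays => x; last by rewrite [LHS]E [RHS]E HF.
by rewrite [ltLHS]E ltry.
Qed.

(** Integrating [f] against the two equal measures of [law_shift] turns each Dirac mass into a point
    value. The additive form avoids subtracting possibly infinite values. *)
Lemma ge0_integral_law_shift {R : realType} {a b : R} {F H : cdf01 R}
    {s : {nonneg R}} {D : set (measurableTypeR R)} {f : measurableTypeR R -> \bar R} :
  mass_moved s%:num a b F H ->
  measurable D -> D a -> D b -> measurable_fun D f -> (forall x, D x -> 0 <= f x)%E ->
  (\int[law H]_(x in D) f x + s%:num%:E * f a =
   \int[law F]_(x in D) f x + s%:num%:E * f b)%E.
Proof.
move=> HF mD Da Db mf f0.
have E (m : {measure set (measurableTypeR R) -> \bar R}) (c : R) : D c ->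
    (\int[measure_add m (mscale s (\d_(c : measurableTypeR R)))]_(x in D) f x =
     \int[m]_(x in D) f x + s%:num%:E * f c)%E.
  move=> Dc; rewrite ge0_integral_measure_add// ge0_integral_mscale//.
  by rewrite integral_dirac// diracE mem_set// mul1e.
rewrite -!E//; apply: eq_measure_integral => A mA _; exact: law_shift.
Qed.

(** Version for the marginal cost, which may change sign: the nonnegative case applies to the
    positive and negative parts, all finite by boundedness. *)
Lemma Rintegral_law_shift {R : realType} {a b : R} {F H : cdf01 R}
    {s : {nonneg R}} {D : set (measurableTypeR R)} {f : measurableTypeR R -> R} :
  mass_moved s%:num a b F H ->
  measurable D -> D a -> D b -> measurable_fun D f -> [bounded f x | x in D] ->
  \int[law H]_(x in D) f x + s%:num * f a =
  \int[law F]_(x in D) f x + s%:num * f b.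
Proof.
move=> HF mD Da Db mf bf.
have intf (G : cdf01 R) : (law G).-integrable D (EFin \o f).
  apply: measurable_bounded_integrable => //.
  by rewrite -ge0_fin_numE// fin_num_measure.
have mEf : measurable_fun D (EFin \o f) by exact/measurable_EFinP.
have fpn c : f c = fine ((EFin \o f)^\+%E c) - fine ((EFin \o f)^\-%E c).
  have := congr1 fine (congr1 (@^~ c) (funeposneg (EFin \o f))).
  by rewrite /= => {1}->; rewrite fineB// ?funerpos ?funerneg.
have fine_eq (x y z t : \bar R) :
    x \is a fin_num -> y \is a fin_num -> z \is a fin_num -> t \is a fin_num ->
    (x + s%:num%:E * y = z + s%:num%:E * t)%E ->
    fine x + s%:num * fine y = fine z + s%:num * fine t.
  by case: x y z t => [x| |] [y| |] [z| |] [t| |] // _ _ _ _ [].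
have fa c : (EFin \o f)^\+%E c \is a fin_num by rewrite funerpos.
have fb c : (EFin \o f)^\-%E c \is a fin_num by rewrite funerneg.
have fH G := integrable_pos_fin_num mD (intf G).
have nH G := integrable_neg_fin_num mD (intf G).
have intE G : \int[law G]_(x in D) f x =
    fine (\int[law G]_(x in D) (EFin \o f)^\+%E x) -
    fine (\int[law G]_(x in D) (EFin \o f)^\-%E x).
  by rewrite [LHS](congr1 fine (integralE (law G) D (EFin \o f))) fineB.
have e1 := fine_eq _ _ _ _ (fH H) (fa a) (fH F) (fa b)
  (ge0_integral_law_shift HF mD Da Db
    (measurable_funepos mEf) (fun x _ => funepos_ge0 _ x)).
have e2 := fine_eq _ _ _ _ (nH H) (fb a) (nH F) (fb b)
  (ge0_integral_law_shift HF mD Da Db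
    (measurable_funeneg mEf) (fun x _ => funeneg_ge0 _ x)).
rewrite (intE H) (intE F) (fpn a) (fpn b) !mulrBr.
by rewrite addrACA -opprD e1 e2 opprD addrACA.
Qed.

Lemma right_continuous_indic_ge {R : realType} (a : R) :
  right_continuous (fun y : R => (a <= y)%R%:R : R).
Proof.
move=> x; apply: cvg_near_cst; have [ax|xa] := leP a x.
  near=> y; have xy : x < y by near: y; exact: nbhs_right_gt.
  by rewrite (le_trans ax (ltW xy)).
near=> y; have ya : y < a by near: y; exact: nbhs_right_lt.
by rewrite leNgt ya.
Unshelve. all: by end_near. Qed.

(** Removing mass [mu] at [a] keeps the function nondecreasing because [F] jumps by at least [mu]
    there; [0 <= a <= b <= 1] preserves the values to the left of 0 and from 1 on. *)
Lemma exists_mass_moved {R : realType} (F : cdf01 R) (mu a b : R) :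
  0 <= a -> a <= b -> b <= 1 -> law F [set a] = mu%:E ->
  exists H, mass_moved mu a b F H.
Proof.
move=> a0 ab b1 Fa.
have mu0 : 0 <= mu by rewrite -lee_fin -Fa.
have jump x : x < a -> F x + mu <= F a.
  move=> xa; rewrite -lee_fin EFinD -Fa -!law_itvNy.
  have mray (z : R) : measurable (`]-oo, z]%classic : set (measurableTypeR R)).
    exact: (@measurable_itv R).
  have ma : measurable ([set a] : set (measurableTypeR R)).
    exact: (@measurable_set1 R).
  have := @measureU _ _ _ (law F) _ _ (mray x) ma.
  move=> <-; last first.
    apply/seteqP; split => // y [] /=; rewrite in_itv/= => yx ya.
    by move: xa; rewrite -ya ltNge yx.
  apply: le_measure; rewrite ?inE//; first exact: measurableU.
  by move=> y [|->] /=; rewrite !in_itv//= => /le_trans; apply; exact: ltW.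
pose h y := F y - mu * (a <= y)%R%:R + mu * (b <= y)%R%:R.
have h_nd : nondecreasing h.
  move=> x y xy; apply: lerD; last first.
    rewrite ler_wpM2l// ler_nat; case: (leP b x) => // bx.
    by rewrite (le_trans bx xy).
  have [ax|xa] := leP a x.
    by rewrite (le_trans ax xy) lerD2r; exact: cdf_nd.
  have [ay|_] := leP a y; last by rewrite lerD2r; exact: cdf_nd.
  (* Here [x < a <= y]: the jump of [F] at [a] pays for the removed mass. *)
  rewrite mulr0 subr0 mulr1 lerBrDr (le_trans (jump _ xa))//; exact: cdf_nd.
have h_rc : right_continuous h.
  move=> x; apply: cvgD; first apply: cvgB; first exact: cdf_rc.
    by apply: cvgMr; exact: right_continuous_indic_ge.
  by apply: cvgMr; exact: right_continuous_indic_ge.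
have h_lt0 x : x < 0 -> h x = 0.
  move=> x0; rewrite /h cdf_lt0// !leNgt (lt_le_trans x0 a0).
  by rewrite (lt_le_trans x0 (le_trans a0 ab)) !mulr0 subrr addr0.
have h_ge1 x : 1 <= x -> h x = 1.
  move=> x1; rewrite /h cdf_ge1// (le_trans b1 x1).
  by rewrite (le_trans (le_trans ab b1) x1) subrK.
by exists (Cdf01 h_nd h_rc h_lt0 h_ge1) => y /=; rewrite /h addrAC subrK.
Qed.

Lemma mass_moved_mix {R : realType} (F H : cdf01 R) (mu a b e : R) :
  0 <= e <= 1 -> mass_moved mu a b F H ->
  mass_moved (e * mu) a b F (mix e F H).
Proof.
move=> e01 FH y; rewrite mixE//.
have -> : H y = F y + mu * (b <= y)%R%:R - mu * (a <= y)%R%:R.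
  by rewrite -FH addrK.
by ring.
Qed.

(** * Expected payoff of player 1 given a fixed own performance *)

Lemma ge0_integral_product_law d (T : measurableType d) (R : realType) n
    (P : 'I_n.+1 -> probability T R) (f : n.+1.-tuple T -> \bar R) :
  measurable_fun setT f -> (forall t, 0 <= f t)%E ->
  (\int[product_law P]_t f t =
   \int[P ord0]_x \int[product_law (fun i => P (lift ord0 i))]_t
     f [tuple of x :: t])%E.
Proof.
move=> mf f0; rewrite /= ge0_integral_distribution// fubini_tonelli1//.
  exact: measurableT_comp mf (@measurable_cons_pair _ _ _).
by move=> x; exact: f0.
Qed.

Lemma ge0_integral_probability_le d (T : measurableType d) (R : realType)
    (P : probability T R) (f : T -> \bar R) (M : R) :
  measurable_fun setT f -> (forall t, 0 <= f t)%E -> (forall t, f t <= M%:E)%E ->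
  (\int[P]_t f t <= M%:E)%E.
Proof.
move=> mf f0 fM; rewrite -[leRHS]mule1 -(probability_setT P) -integral_cst//.
exact: ge0_le_integral.
Qed.

Section interim_payoff.
Context {R : realType} {m : nat}.
Variables (g : 'I_m.+1 -> {ptws 'I_m.+1 -> R} -> R) (pibar : R).
Hypothesis g_borel : payoffs_borel g.
Hypothesis g_bounded : payoffs_bounded g pibar.

Let T := measurableTypeR R.
Let cubeT : set (m.+1.-tuple T) := [set t | cube (tnth t)].

(** Extension by 0 off the cube, so that integrals run over the whole space and Tonelli applies
    directly. *)
Definition payoff_ext : m.+1.-tuple T -> \bar R :=
  (fun t => (g ord0 (tnth t))%:E) \_ cubeT.

(** Expected gross payoff of player 1 when performing exactly [x] against [m] independent draws from
    [F]. *)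
Definition interim_payoff (F : cdf01 R) (x : T) : \bar R :=
  (\int[product_law (fun _ : 'I_m => law F)]_t payoff_ext [tuple of x :: t])%E.

Lemma measurable_cubeT : measurable cubeT.
Proof.
have -> : cubeT = \bigcap_(i in [set: 'I_m.+1]) (@tnth _ T ^~ i @^-1` `[0, 1]%classic).
  by apply/seteqP; split => [t h i _|t h i]; [exact: h|exact: (h i)].
apply: fin_bigcap_measurable => // i _.
rewrite -[X in measurable X]setTI; apply: measurable_tnth => //.
Qed.

Lemma payoff_ext_ge0 t : (0 <= payoff_ext t)%E.
Proof.
apply: erestrict_ge0 => {}t ct; rewrite lee_fin.
by have /andP[] := g_bounded ord0 _ ct.
Qed.

Lemma payoff_ext_le t : (payoff_ext t <= pibar%:E)%E.
Proof.
(* The bounds at the origin give [0 <= pibar], which covers the value 0 off the cube. *)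
have /andP[g0 gM] : 0 <= g ord0 (fun=> 0) <= pibar.
  apply: g_bounded => j.
  by rewrite in_itv/= lexx ler01.
rewrite /payoff_ext /patch; case: ifPn => [|_]; rewrite ?lee_fin.
  by rewrite inE => ct; have /andP[] := g_bounded ord0 _ ct.
exact: le_trans g0 gM.
Qed.

Lemma measurable_payoff_ext : measurable_fun setT payoff_ext.
Proof.
apply/(measurable_restrictT _ measurable_cubeT).
by apply/measurable_EFinP; exact: g_borel.
Qed.

Lemma measurable_payoff_ext_cons x :
  measurable_fun setT (fun t : m.-tuple T => payoff_ext [tuple of x :: t]).
Proof.
apply: measurableT_comp measurable_payoff_ext _.
exact: measurable_cons.
Qed.

Lemma interim_payoff_ge0 F x : (0 <= interim_payoff F x)%E.
Proof. by apply: integral_ge0 => t _; exact: payoff_ext_ge0. Qed.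

Lemma interim_payoff_le F x : (interim_payoff F x <= pibar%:E)%E.
Proof.
apply: ge0_integral_probability_le => [|t|t].
- exact: measurable_payoff_ext_cons.
- exact: payoff_ext_ge0.
- exact: payoff_ext_le.
Qed.

Lemma interim_payoff_fin_num F x : interim_payoff F x \is a fin_num.
Proof.
rewrite ge0_fin_numE ?interim_payoff_ge0//.
exact: le_lt_trans (interim_payoff_le F x) (ltry _).
Qed.

Lemma measurable_interim_payoff F : measurable_fun setT (interim_payoff F).
Proof.
apply: (@measurable_fun_fubini_tonelli_F _ _ _ _ _ _ (payoff_ext \o @cons_pair _ T m)).
  exact: measurableT_comp measurable_payoff_ext (@measurable_cons_pair _ _ _).
by move=> x; exact: payoff_ext_ge0.
Qed.

(** Integrating the opponents out first shows that the gross payoff is linear in the deviator's own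
    law. *)
Lemma net_payoff_interim (C : cdf01 R -> R) (F H : cdf01 R) :
  net_payoff g C ord0 (fun j => if j == ord0 then H else F) =
  fine (\int[law H]_x interim_payoff F x)%E - C H.
Proof.
rewrite /net_payoff eqxx; congr (fine _ - _).
rewrite integral_mkcond ge0_integral_product_law//; last 2 first.
- exact: measurable_payoff_ext.
- exact: payoff_ext_ge0.
Qed.

Lemma integral_interim_payoff_fin_num (F H : cdf01 R) :
  (\int[law H]_x interim_payoff F x)%E \is a fin_num.
Proof.
rewrite ge0_fin_numE; last by apply: integral_ge0 => x _; exact: interim_payoff_ge0.
apply: le_lt_trans (ltry pibar); apply: ge0_integral_probability_le => [|x|x].
- exact: measurable_interim_payoff.
- exact: interim_payoff_ge0.
- exact: interim_payoff_le.
Qed.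

(* With probability [mu ^+ m] every opponent performs exactly [a]; only these
   ties with player 1 contribute to the strict part of the bound. *)
Lemma interim_payoff_gap (F : cdf01 R) (a b Delta mu : R) :
  (0 < m)%N -> payoffs_monotone g -> 0 < a -> a < b -> b <= 1 -> 0 <= Delta ->
  law F [set a] = mu%:E ->
  (forall z, cube z -> \big[Num.max/0]_(j < m.+1 | j != ord0) z j = a ->
    g ord0 (upd z ord0 a) + Delta <= g ord0 (upd z ord0 b)) ->
  (interim_payoff F a + (Delta * mu ^+ m)%:E <= interim_payoff F b)%E.
Proof.
move=> m0 g_mono a0 ab b1 D0 Fa tie.
pose Q := product_law (fun _ : 'I_m => law F).
pose B : set (m.-tuple T) := [set t | forall i, [set a] (tnth t i)].
have mB : measurable B.
  have -> : B = \bigcap_(i in [set: 'I_m]) (@tnth _ T ^~ i @^-1` [set a]).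
    by apply/seteqP; split => [t h i _|t h i]; [exact: h|exact: (h i)].
  apply: fin_bigcap_measurable => // i _.
  by rewrite -[X in measurable X]setTI; apply: measurable_tnth.
have QB : Q B = (mu ^+ m)%:E.
  have ma : measurable ([set a] : set T) by exact: (@measurable_set1 R).
  rewrite [LHS](product_law_box (fun=> law F) (A := fun=> [set a]))//.
  by rewrite (eq_bigr (fun=> mu%:E))// prodEFin big_const_ord iter_mulr_1.
have mD : measurable_fun setT (fun t => Delta%:E * (\1_B t)%:E)%E.
  apply: measurable_funeM; apply/measurable_EFinP; exact: measurable_indic.
(* The constant [Delta * mu ^+ m] becomes the integral of [Delta] times the indicator of [B], which
   reduces the claim to a pointwise inequality in the opponents' profile [t]. *)
rewrite EFinM -QB -[B]setIT -integral_indic//.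
rewrite -ge0_integralZl_EFin//; last first.
  by apply/measurable_EFinP; exact: measurable_indic.
rewrite /interim_payoff -ge0_integralD//; first last.
- by move=> t _; rewrite mule_ge0// lee_fin.
- exact: measurable_payoff_ext_cons.
- by move=> t _; exact: payoff_ext_ge0.
apply: ge0_le_integral => //.
- by move=> t _; rewrite adde_ge0 ?payoff_ext_ge0 ?mule_ge0 ?lee_fin.
- by apply: emeasurable_funD => //; exact: measurable_payoff_ext_cons.
- exact: measurable_payoff_ext_cons.
move=> t _; pose z : {ptws 'I_m.+1 -> R} := tnth [tuple of a :: t].
have updz x : tnth [tuple of x :: t] = upd z ord0 x.
  apply/funext => j; rewrite /upd /z.
  by case: (unliftP ord0 j) => [i ->|->//]; rewrite !tnthS.
have cube_upd x : x \in `[0, 1] -> cube (upd z ord0 x) <-> cube (tnth t).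
  move=> x01; rewrite -updz; split=> [h i|h j].
    by have := h (lift ord0 i); rewrite tnthS.
  by case: (unliftP ord0 j) => [i ->|->//]; rewrite tnthS.
have a01 : a \in `[0, 1] by rewrite in_itv/= (ltW a0) (ltW (lt_le_trans ab b1)).
have b01 : b \in `[0, 1] by rewrite in_itv/= (ltW (lt_trans a0 ab)).
have za : upd z ord0 a = z by rewrite -updz.
have extE x : x \in `[0, 1] -> payoff_ext [tuple of x :: t] =
    if `[< cube (tnth t) >] then (g ord0 (upd z ord0 x))%:E else 0%E.
  move=> x01; rewrite /payoff_ext /patch -updz; case: asboolP => ct.
    by rewrite mem_set// /cubeT/= updz; apply/cube_upd.
  by rewrite memNset// /cubeT/= updz => /cube_upd -/(_ x01).
(* Off the cube both payoffs are 0 and [t] is not in [B], since [a] lies in [[0, 1]]. *)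
rewrite !extE//; case: asboolP => ct; last first.
  rewrite indicE memNset ?mule0 ?adde0// => tB; apply: ct => i.
  by rewrite tB.
have cz : cube z by rewrite -za; apply/cube_upd.
(* Off [B] monotonicity suffices; on [B] the tie hypothesis applies. *)
rewrite -EFinM -EFinD lee_fin indicE; have [tB|_] := boolP (t \in B); last first.
  rewrite mulr0 addr0 za; apply: g_mono => //; exact: ltW.
rewrite mulr1; apply: tie => //.
have zE j : j != ord0 -> z j = a.
  move: tB; rewrite inE => tB.
  by case: (unliftP ord0 j) => [i -> _|->//]; rewrite /z tnthS tB.
rewrite (eq_bigr (fun=> a))//.
apply/eqP; rewrite eq_le; apply/andP; split.
  by apply/bigmax_leP; split => //; exact: ltW.
(* The maximum starts from the default 0, so an actual opponent is needed to reach [a > 0]; [m0]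
   supplies one. *)
by apply: (le_bigmax_cond _ _ (j := lift ord0 (Ordinal m0))).
Qed.

End interim_payoff.

(** * First-order condition and absence of interior atoms *)

(* First-order condition for shifting the mass [mu] from [a] to [b]: compare
   [F] with the mixtures (1 - e) F + e H and let e tend to 0. *)
Lemma equilibrium_mass_moved {R : realType} {m : nat}
    (g : 'I_m.+1 -> {ptws 'I_m.+1 -> R} -> R) (pibar : R)
    (C : cdf01 R -> R) (c : cdf01 R -> R -> R) (F H : cdf01 R) (mu a b : R) :
  payoffs_borel g -> payoffs_bounded g pibar -> cost_derivative C c ->
  symmetric_equilibrium g C ord0 F ->
  0 < mu -> a \in `[0, 1] -> b \in `[0, 1] -> mass_moved mu a b F H ->
  fine (interim_payoff g F b) - fine (interim_payoff g F a) <= c F b - c F a.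
Proof.
move=> g_borel g_bdd Cc eqF mu0 a01 b01 FH.
have [cF dC] := Cc F.
set pb := fine _; set pa := fine _.
(* The mixture moves mass [e * mu], so the gross payoff is exactly affine in [e]; only the cost
   requires a limit. *)
have payoff_mix e : 0 < e <= 1 ->
    fine (\int[law (mix e F H)]_x interim_payoff g F x)%E =
    fine (\int[law F]_x interim_payoff g F x)%E + e * mu * (pb - pa).
  move=> /andP[e0 e1].
  have emu0 : 0 <= e * mu by rewrite mulr_ge0// ltW.
  have e01 : 0 <= e <= 1 by rewrite (ltW e0).
  have := ge0_integral_law_shift (s := NngNum emu0) (mass_moved_mix _ _ _ _ _ _ e01 FH)
    measurableT I I (measurable_interim_payoff _ _ g_borel g_bdd F)
    (fun x _ => interim_payoff_ge0 _ _ g_bdd F x).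
  have fin := integral_interim_payoff_fin_num _ _ g_borel g_bdd F.
  rewrite /pa /pb -(fineK (fin F)) -(fineK (fin (mix e F H))).
  rewrite -(fineK (interim_payoff_fin_num _ _ g_borel g_bdd F a)).
  rewrite -(fineK (interim_payoff_fin_num _ _ g_borel g_bdd F b)) /=.
  rewrite -!EFinM -!EFinD => -[] /=; lra.
have cshift : \int[law H]_(x in `[0, 1]) c F x - \int[law F]_(x in `[0, 1]) c F x
    = mu * (c F b - c F a).
  pose D : set (measurableTypeR R) := `[0, 1]%classic.
  have mD : measurable D by exact: (@measurable_itv R).
  have mc : measurable_fun D (c F : measurableTypeR R -> R).
    by apply: subspace_continuous_measurable_fun.
  have bc : [bounded c F x | x in D].
    have /compact_bounded[M [_ mrt]] := continuous_compact cF (@segment_compact _ 0 1).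
    by exists M; split; rewrite ?num_real // => ? ? ? ?; exact: mrt.
  have := Rintegral_law_shift (s := NngNum (ltW mu0)) FH mD a01 b01 mc bc.
  rewrite /=; lra.
suff : mu * (pb - pa) <= mu * (c F b - c F a) by rewrite ler_pM2l.
(* By equilibrium each cost difference quotient with [0 < e <= 1] is at least [mu * (pb - pa)]; the
   bound passes to the limit. *)
rewrite -cshift; apply: cvgr_to_ge (dC H) _.
near=> e.
have e0 : 0 < e by near: e; exact: nbhs_right_gt.
have e1 : e <= 1 by near: e; exact: nbhs_right_le.
rewrite ler_pdivlMl//.
have := eqF (mix e F H); rewrite (net_payoff_interim _ _ g_borel g_bdd)//.
(* The equilibrium profile is read as a trivial deviation to [F], so that both payoffs have the same
   form. *)
have -> : (fun=> F) = (fun j : 'I_m.+1 => if j == ord0 then F else F).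
  by apply/funext => j; case: ifP.
rewrite (net_payoff_interim _ _ g_borel g_bdd)// payoff_mix ?e0//; lra.
Unshelve. all: by end_near. Qed.

Theorem lemma3p4 (R : realType) (n : nat) (hn : (1 < n)%N)
    (g : 'I_n -> {ptws 'I_n -> R} -> R) (pibar : R)
    (C : cdf01 R -> R) (c : cdf01 R -> R -> R) (F : cdf01 R) :
  let player1 : 'I_n := Ordinal (ltnW hn) in
  payoffs_borel g ->
  payoffs_bounded g pibar ->
  payoffs_symmetric g ->
  payoffs_continuous_off_ties g ->
  payoffs_monotone g ->
  payoffs_total_continuous g ->
  cost_convex C ->
  continuous C ->
  cost_derivative C c ->
  cost_slope c pibar ->
  strict_tie_disadvantage g player1 ->
  symmetric_equilibrium g C player1 F ->
  forall x : R, 0 < x < 1 -> law F [set x] = 0%E.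
Proof.
case: n hn g => // m hn g player1 g_borel g_bdd _ _ g_mono _ _ _ Cc _.
have -> : player1 = ord0 by exact: val_inj.
move=> tie eqF x x01; have /andP[x0 x1] := x01.
have m0 : (0 < m)%N by exact: hn.
have [mu Fx] : exists mu : R, law F [set x] = mu%:E.
  exists (fine (law F [set x])); rewrite fineK//; apply: fin_num_measure.
  exact: (@measurable_set1 R x).
have : 0 <= mu by rewrite -lee_fin -Fx.
rewrite le_eqVlt => /predU1P[mu0|mu0]; first by rewrite Fx -mu0.
exfalso.
have [delta [Delta [/andP[d0 d1] D0 tiex]]] := tie x x01.
have kappa0 : 0 < Delta * mu ^+ m by rewrite mulr_gt0// exprn_gt0.
(* The lower bound on the rise of the marginal cost does not depend on [e]; here [m] is the number
   of opponents. *)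
have gap e : 0 < e <= delta -> c F x + Delta * mu ^+ m <= c F (x + e).
  move=> /andP[e0 ed].
  have xe1 : x + e <= 1 by rewrite -lerBrDl (le_trans ed).
  have xxe : x <= x + e by rewrite lerDl ltW.
  have [H FH] := exists_mass_moved F mu x (x + e) (ltW x0) xxe xe1 Fx.
  have := equilibrium_mass_moved g pibar C c F H mu x (x + e)
    g_borel g_bdd Cc eqF mu0 _ _ FH.
  have xI : x \in `[0, 1] by rewrite in_itv/= !ltW.
  have xeI : x + e \in `[0, 1] by rewrite in_itv/= xe1 addr_ge0// ltW.
  move=> /(_ xI xeI).
  have := interim_payoff_gap g pibar g_borel g_bdd F x (x + e) Delta mu m0 g_mono x0
    _ xe1 (ltW D0) Fx.
  rewrite ltrDl => /(_ e0)/(_ (fun z cz zx => tiex z cz zx e _)).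
  rewrite -(fineK (interim_payoff_fin_num g pibar g_borel g_bdd F x)).
  rewrite -(fineK (interim_payoff_fin_num g pibar g_borel g_bdd F (x + e))).
  rewrite -EFinD lee_fin e0 ed => /(_ isT); lra.
(* As [x] is interior, continuity within [[0, 1]] is continuity at [x]. *)
have cx : {for x, continuous (c F)}.
  by apply: within_continuous_continuous (Cc F).1 _; rewrite ?ltr01// in_itv/= x0.
have : \forall y \near x^'+, `|c F x - c F y| < Delta * mu ^+ m.
  apply: cvgr_dist_lt => //; exact: cvg_at_right_filter.
move=> cnear.
have [y [xy yd cy]] : exists y, [/\ x < y, y <= x + delta &
    `|c F x - c F y| < Delta * mu ^+ m].
  near x^'+ => y; exists y; split; near: y => //.
  - exact: nbhs_right_gt.
  - by apply: nbhs_right_le; rewrite ltrDl.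
(* With [e = y - x] the uniform gap contradicts the closeness of [c F y] to [c F x]. *)
have := gap (y - x); rewrite subr_gt0 xy lerBlDl yd subrKC => /(_ isT).
move: cy; rewrite ltr_norml => /andP[]; lra.
Unshelve. all: by end_near. Qed.
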